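(* Let $0<q<1$, set $\alpha=\frac{2q}{1-q}$ and $$\phi(x)=\frac{1}{1+\alpha(1-x)+\frac{\alpha^2}{2}(1-x)},\qquad x\in[-1,1].$$ Then $P_{2r+1}(\lambda,\beta)=T^{\phi}_{2r+1}(\lambda,\beta)$ for all integers $r\ge 0$ and all $\lambda,\beta\in\mathcal W_{2r+1}$, and $P_{2r}(\lambda,\beta)=T^{\phi}_{2r}(\lambda,\beta)$ for all integers $r\ge 1$ and all $\lambda,\beta\in\mathcal W_{2r}$.
   Context: $\mathbb N=\{0,1,2,\dots\}$. For $k\ge1$ let $r_k=\lfloor\frac{k+1}{2}\rfloor$ and $\mathcal W_k=\{(\lambda_1\ge\dots\ge\lambda_{r_k}):\lambda_i\in\mathbb N\}$. For $\lambda\in\mathcal W_k$ put $\tilde\lambda_i=\lambda_i+r_k-i$. Let $a_k=-1/2$ if $k$ is odd and $a_k=1/2$ if $k$ is even. Interlacing: if $\lambda=(\lambda_1\ge\dots\ge\lambda_r)$ and $\mu=(\mu_1\ge\dots\ge\mu_r)$ or $\mu=(\mu_1\ge\dots\ge\mu_{r+1})$, write $\lambda\prec\mu$ if $\mu_{i+1}\le\lambda_i$ and $\lambda_i\le\mu_i$ for all values of $i$ for which these make sense. The notation $c\prec\lambda,\beta$ means $c\prec\lambda$ and $c\prec\beta$, where $c=(c_1\ge\dots\ge c_r)$. For $\lambda\in\mathcal W_k$ with $k=2r$ or $k=2r-1$ (so $r_k=r$), let $l_i=\lambda_i+(r-i)+1$, $m_i=(r-i)+1$, $l_i'=l_i-\frac12$,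 $m_i'=m_i-\frac12$ for $1\le i\le r$, and $$s_{2r}(\lambda)=\prod_{1\le i<j\le r}\frac{l_i^2-l_j^2}{m_i^2-m_j^2}\prod_{1\le i\le r}\frac{l_i}{m_i},\qquad s_{2r-1}(\lambda)=\prod_{1\le i<j\le r}\frac{l_i'^2-l_j'^2}{m_i'^2-m_j'^2}.$$ For $n\in\mathbb N$ the Jacobi polynomials $J_{n,\pm1/2}$ are the polynomials determined by $$J_{n,1/2}\Big(\frac{z+z^{-1}}2\Big)=\frac{z^{n+1}-z^{-(n+1)}}{z-z^{-1}},\qquad J_{n,-1/2}\Big(\frac{z+z^{-1}}2\Big)=\frac{z^{n+1/2}+z^{-(n+1/2)}}{z^{1/2}+z^{-1/2}}.$$ For $a=\pm\frac12$ let $\langle f,g\rangle_a=\frac{2^{a+1/2}}{\pi}\int_{-1}^1f(x)g(x)(1-x)^a(1+x)^{1/2}\,dx$. For $\lambda,\mu\in\mathcal W_k$ define $$T_k^{\phi}(\lambda,\mu)=\det\Big[\big\langle J_{\tilde\lambda_i,a_k},\,J_{\tilde\mu_j,a_k}\phi\big\rangle_{a_k}\Big]_{i,j=1}^{r_k}\frac{s_k(\mu)}{s_k(\lambda)}.$$ For $x,y\in\mathbb N$ let $R(x,y)=\frac{1-q}{1+q}\left(q^{|x-y|}+q^{x+y+1}\right)$. Define $$P_{2r+1}(\lambda,\beta)=\sum_{c\in\mathbb N^r,\ c\prec\lambda,\beta}(1-q)^{2r}\frac{s_{2r+1}(\beta)}{s_{2r+1}(\lambda)}\,q^{\sum_{i=1}^r(\lambda_i+\beta_i-2c_i)}R(\lambda_{r+1},\beta_{r+1}),$$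 $$P_{2r}(\lambda,\beta)=\sum_{c\in\mathbb N^r,\ c\prec\lambda,\beta}(1-q)^{2r}\frac{s_{2r}(\beta)}{s_{2r}(\lambda)}\,q^{\sum_{i=1}^r(\lambda_i+\beta_i-2c_i)}.$$ (For $r=0$ the sum defining $P_1$ has the single, empty, term, so $P_1=R$.) *)

(* Defs.v *)
From HB Require Import structures.
From mathcomp Require Import all_boot all_order all_algebra.
From mathcomp Require Import complex.
From mathcomp Require Import all_classical all_reals all_analysis.
From mathcomp Require Import ring lra.

Set Implicit Arguments.
Unset Strict Implicit.
Unset Printing Implicit Defensive.

Import Order.TTheory GRing.Theory Num.Theory.

Local Open Scope classical_set_scope.
Local Open Scope ring_scope.

(* Sequences (x_1, ..., x_r) are stored 0-indexed: x_i is nth 0 x (i - 1). *)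

Definition rk (k : nat) : nat := (k.+1)./2.

Definition W (k : nat) : set ((rk k).-tuple nat) :=
  [set l | sorted geq (l : seq nat)].
Arguments W k : clear implicits.

(* entries of \tilde\lambda: \lambda_i + r - i with i 1-based *)
Definition shifted (l : seq nat) (i : nat) : nat :=
  (nth 0 l i + (size l - i.+1))%N.

Definition interlace (c l : seq nat) : Prop :=
  [/\ size l = size c \/ size l = (size c).+1,
      forall i, (i < size c)%N -> (i.+1 < size l)%N ->
        (nth 0 l i.+1 <= nth 0 c i)%N
    & forall i, (i < size c)%N -> (i < size l)%N ->
        (nth 0 c i <= nth 0 l i)%N].

Definition interlacing (r : nat) (l b : seq nat) : set (r.-tuple nat) :=
  [set c | [/\ sorted geq (c : seq nat), interlace c l & interlace c b]].
Arguments interlacing r l b : clear implicits.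

(* The sums \sum_(c \in A) below are taken over A only when A is finite
   (they are 0 by convention otherwise). *)
Lemma finite_interlacing (r : nat) (l b : seq nat) :
  finite_set (interlacing r l b).
Proof.
pose N := (\max_(x <- l) x)%N.
pose f (t : {ffun 'I_r -> 'I_N.+1}) : r.-tuple nat := [tuple nat_of_ord (t i) | i < r].
apply: (@sub_finite_set _ _ [set f t | t in setT]); last first.
  by apply: finite_image; exact: finite_finset.
move=> c [_ [sz _ cl] _].
exists [ffun i => inord (tnth c i)] => //.
apply: eq_from_tnth => i; rewrite tnth_mktuple ffunE inordK // ltnS.
have ic : (i < size c)%N by rewrite size_tuple.
have il : (i < size l)%N.
  by case: sz => ->; rewrite ?ltnS ?size_tuple // ltnW.
rewrite (tnth_nth 0%N); apply: leq_trans (cl i ic il) _.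
by apply: (@leq_bigmax_seq _ l xpredT id) => //; exact: mem_nth.
Qed.

Section Defs.
Variable R : realType.
Implicit Types (a q : R) (n k r : nat).

Definition a_ k : R := if odd k then - 2^-1 else 2^-1.

Definition s (k : nat) (l : seq nat) : R :=
  let r := rk k in
  let L i : R := (nth 0%N l i + (r - i.+1) + 1)%N%:R in
  let M i : R := (r - i.+1 + 1)%N%:R in
  let L' i := L i - 2^-1 in
  let M' i := M i - 2^-1 in
  if odd k then
    \prod_(j < r) \prod_(i < j) ((L' i ^+ 2 - L' j ^+ 2) / (M' i ^+ 2 - M' j ^+ 2))
  else
    (\prod_(j < r) \prod_(i < j) ((L i ^+ 2 - L j ^+ 2) / (M i ^+ 2 - M j ^+ 2)))
    * \prod_(i < r) (L i / M i).

Local Notation toC := (real_complex R).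

(* For a = -1/2 the variable w is z^{1/2}; both square roots of z give the
   same value. Nothing is required when a is not 1/2 or -1/2. *)
Definition jacobi_spec a n : set {poly R} :=
  [set p |
    (a = 2^-1 -> forall z : R[i], z != 0 -> z - z^-1 != 0 ->
       (map_poly toC p).[(z + z^-1) / 2]
       = (z ^+ n.+1 - z ^- n.+1) / (z - z^-1)) /\
    (a = - 2^-1 -> forall w : R[i], w != 0 -> w + w^-1 != 0 ->
       (map_poly toC p).[(w ^+ 2 + w ^- 2) / 2]
       = (w ^+ (2 * n + 1) + w ^- (2 * n + 1)) / (w + w^-1))].

Definition jacobi n a : {poly R} := xget 0 (jacobi_spec a n).

Definition inner a (f g : R -> R) : R :=
  2 `^ (a + 2^-1) / pi
  * \int[lebesgue_measure]_(x in `[-1, 1])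
      (f x * g x * (1 - x) `^ a * (1 + x) `^ 2^-1).

Definition T k (phi : R -> R) (l m : seq nat) : R :=
  \det (\matrix_(i < rk k, j < rk k)
          inner (a_ k) (fun x => (jacobi (shifted l i) (a_ k)).[x])
                       (fun x => (jacobi (shifted m j) (a_ k)).[x] * phi x))
  * (s k m / s k l).

Definition Rker q (x y : nat) : R :=
  (1 - q) / (1 + q) * (q ^+ `|x%:Z - y%:Z|%N + q ^+ (x + y + 1)).

(* The truncated subtraction is exact: c_i is at most both l_i and b_i. *)
Definition weight q r (l b c : seq nat) : R :=
  q ^+ (\sum_(i < r) (nth 0 l i + nth 0 b i - 2 * nth 0 c i))%N.

Definition P_odd q r (l b : seq nat) : R :=
  \sum_(c \in interlacing r l b)
    ((1 - q) ^+ (2 * r) * (s (2 * r + 1) b / s (2 * r + 1) l)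
     * weight q r l b c * Rker q (nth 0%N l r) (nth 0%N b r)).

Definition P_even q r (l b : seq nat) : R :=
  \sum_(c \in interlacing r l b)
    ((1 - q) ^+ (2 * r) * (s (2 * r) b / s (2 * r) l) * weight q r l b c).

Definition phi q (x : R) : R :=
  let alpha := 2 * q / (1 - q) in
  (1 + alpha * (1 - x) + alpha ^+ 2 / 2 * (1 - x))^-1.

Fixpoint cheb_rec (p1 : {poly R}) n : {poly R} * {poly R} :=
  if n is m.+1 then
    let: (u, v) := cheb_rec p1 m in (v, 'X *+ 2 * v - u)
  else (1, p1).

Let horner_toC (p : {poly R}) x : (map_poly toC p).[toC x] = toC p.[x].
Proof. exact: horner_map. Qed.

Lemma jacobi_spec_ex a n : a = 2^-1 \/ a = - 2^-1 ->
  exists p, jacobi_spec a n p.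
Proof.
have cc (u v : {poly R}) x : (map_poly toC ('X *+ 2 * v - u)).[x]
   = 2 * x * (map_poly toC v).[x] - (map_poly toC u).[x].
  by rewrite rmorphB rmorphM rmorphMn /= map_polyX !hornerE; ring.
move=> [->|->].
- exists (cheb_rec ('X *+ 2) n).1; split => [_ z z0 zz|h]; last by exfalso; lra.
  suff: (map_poly toC (cheb_rec ('X *+ 2) n).1).[(z + z^-1) / 2]
           = (z ^+ n.+1 - z ^- n.+1) / (z - z^-1) /\
        (map_poly toC (cheb_rec ('X *+ 2) n).2).[(z + z^-1) / 2]
           = (z ^+ n.+2 - z ^- n.+2) / (z - z^-1) by case.
  elim: n => [|n] /=.
    rewrite rmorph1 rmorphMn /= map_polyX !hornerE expr1 divff //; split => //.
    by apply: (mulIf zz); rewrite divfK // -exprVn; field.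
  case: (cheb_rec _ n) => u v [/= Hu Hv]; split => //.
  rewrite cc /= Hu Hv.
  have z2 : z * z - 1 != 0.
    by apply: contra zz => /eqP zz1; rewrite -(mulIr_eq0 _ (mulIf z0)) mulrBl mulVf // zz1.
  by rewrite -!exprVn !exprS; field; rewrite ?z0 ?z2.
- exists (cheb_rec ('X *+ 2 - 1) n).1; split => [h|_ z z0 zz]; first by exfalso; lra.
  suff: (map_poly toC (cheb_rec ('X *+ 2 - 1) n).1).[(z ^+ 2 + z ^- 2) / 2]
           = (z ^+ (2 * n + 1) + z ^- (2 * n + 1)) / (z + z^-1) /\
        (map_poly toC (cheb_rec ('X *+ 2 - 1) n).2).[(z ^+ 2 + z ^- 2) / 2]
           = (z ^+ (2 * n.+1 + 1) + z ^- (2 * n.+1 + 1)) / (z + z^-1) by case.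
  elim: n => [|n] /=.
    rewrite rmorph1 rmorphB rmorphMn rmorph1 /= map_polyX !hornerE expr1 divff //.
    split => //.
    by apply: (mulIf zz); rewrite divfK // -!exprVn; field.
  case: (cheb_rec _ n) => u v [/= Hu Hv]; split => //.
  rewrite cc /= Hu Hv.
  have z2 : z * z + 1 != 0.
    by apply: contra zz => /eqP zz1; rewrite -(mulIr_eq0 _ (mulIf z0)) mulrDl mulVf // zz1.
  have -> : (2 * n.+2 + 1 = (2 * n + 1).+4)%N by rewrite !mulnS.
  have -> : (2 * n.+1 + 1 = (2 * n + 1).+2)%N by rewrite !mulnS.
  by rewrite -!exprVn !exprS; field; rewrite ?z0 ?z2.
Qed.

Lemma jacobi_spec_uniq a n p p' : a = 2^-1 \/ a = - 2^-1 ->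
  jacobi_spec a n p -> jacobi_spec a n p' -> p = p'.
Proof.
move=> ha hp hp'.
have key x : 1 < x -> p.[x] = p'.[x].
  move=> x1; apply: (@complexI R); rewrite -!horner_toC.
  pose t := toC (Num.sqrt (x ^+ 2 - 1)).
  have t0 : t != 0.
    by rewrite (inj_eq (@complexI R) _ 0) sqrtr_eq0 -ltNge; nra.
  have t2 : t ^+ 2 = toC x ^+ 2 - 1.
    by rewrite -rmorphXn sqr_sqrtr ?rmorphB ?rmorphXn ?rmorph1 //; nra.
  pose z := toC x + t.
  have zz' : z * (toC x - t) = 1.
    by rewrite mulrC -subr_sqr t2; ring.
  have z0 : z != 0 by apply/eqP => z0; move: zz' => /eqP; rewrite z0 mul0r eq_sym oner_eq0.
  have zV : z^-1 = toC x - t by rewrite -[z^-1]mulr1 -zz' mulKf.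
  have -> : toC x = (z + z^-1) / 2 by rewrite zV /z; field.
  case: ha => ea.
    have zz : z - z^-1 != 0.
      have -> : z - z^-1 = t * 2 by rewrite zV /z; ring.
      by rewrite mulf_neq0 // pnatr_eq0.
    by rewrite (hp.1 ea) // (hp'.1 ea).
  pose w := sqrtC z.
  have w2 : w ^+ 2 = z by rewrite sqrtCK.
  have w0 : w != 0 by rewrite sqrtC_eq0.
  have ww : w + w^-1 != 0.
    apply/eqP => /(congr1 (fun u => u * w)); rewrite mul0r mulrDl mulVf // -expr2 w2 => zN.
    have {}zN : z = -1 by apply/eqP; rewrite -subr_eq0 opprK zN.
    have : z + z^-1 = 2 * toC x by rewrite zV /z; ring.
    rewrite zN invrN1 => h.
    have /complexI : toC x = toC (-1).
      rewrite rmorphN1; apply: (@mulfI _ 2); first by rewrite pnatr_eq0.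
      by rewrite -h; ring.
    by move=> xN; move: x1; rewrite xN; lra.
  by rewrite -w2 (hp.2 ea) // (hp'.2 ea).
apply/eqP; rewrite -subr_eq0; apply: contraT => d0.
have := @max_poly_roots _ (p - p') [seq i.+2%:R | i <- iota 0 (size (p - p'))] d0.
rewrite size_map size_iota ltnn; apply.
  apply/allP => _ /mapP[i _ ->]; rewrite rootE !hornerE key ?subrr //.
  by rewrite ltr1n.
rewrite map_inj_uniq ?iota_uniq // => i j /eqP.
by rewrite eqr_nat => /eqP[].
Qed.

Lemma jacobiP a n : a = 2^-1 \/ a = - 2^-1 -> jacobi_spec a n (jacobi n a).
Proof. by move=> ha; apply: xgetPex; exact: jacobi_spec_ex. Qed.

End Defs.

(* Main.v *)
(** In the angular variable [x = cos t] the Jacobi polynomials are quotients of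
    sines (resp. cosines) and [phi] is [(1-q)/(1+q)] times the Poisson kernel
    [(1-q^2)/(1 - 2 q cos t + q^2)].  Its cosine moments obey a three-term
    recurrence whose only bounded solution is geometric, so the entries of the
    determinant are [(1-q)/(1+q) (q^|m-n| - q^(m+n+2))] for even [k] and
    [R(m,n)] for odd [k].
    Both kernels have the form [sum_c w_c q^(m-c) q^(n-c)] over
    [c <= min(m,n)].  Subtracting from each row a multiple of the next one, and
    likewise for columns, restricts [c] to the intersection of a block
    [x_(i+1) < c <= x_i] of the rows with a block [y_(j+1) < c <= y_j] of the
    columns.  The blocks are linearly ordered, so only the identity permutation
    contributes to the determinant, and the product of the diagonal entries,
    once expanded, is the sum over interlacing [c]. *)

Require Import Defs.
From mathcomp Require Import all_boot all_order all_algebra all_fingroup.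
From mathcomp Require Import complex.
From mathcomp Require Import all_classical all_reals all_analysis.
From mathcomp Require Import measurable_realfun ring lra zify.
Import Order.TTheory GRing.Theory Num.Theory.
Import numFieldNormedType.Exports.
Local Open Scope classical_set_scope.
Local Open Scope ring_scope.

(** * The substitution x = cos t *)

Section CosSubstitution.
Variable R : realType.
Local Notation mu := (@lebesgue_measure R).

(** Staying [e] away from both ends keeps the image segment inside []-1, 1[], where [G] is
    continuous. The cosine decreases, and the resulting sign cancels that of its derivative
    [- sin]. *)
Lemma integral_cos_subst_segment (G : R -> R) (e : R) : 0 < e -> e <= pi / 2 ->
  {in `]-1, 1[, continuous G} ->
  (\int[mu]_(x in `[(- cos e)%R, (cos e)%R]) (G x)%:E =
   \int[mu]_(t in `[e, (pi - e)%R]) (G (cos t) * sin t)%:E)%E.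
Proof.
move=> e0 e2 cG.
have p0 : 0 < pi :> R by exact: pi_gt0.
have cos_decr : {in `[e, pi - e] &, {homo @cos R : x y /~ x < y}}.
  move=> x y; rewrite !in_itv/= => /andP[x1 x2] /andP[y1 y2] xy.
  by rewrite ltr_cos // in_itv/=; apply/andP; split; lra.
have cB : cos (pi - e) = - cos e :> R by rewrite cosB cospi sinpi; ring.
have dcos : derive1 (@cos R) = - @sin R.
  by apply/funext => x; rewrite derive1E derive_val.
have ccos x : {for x, continuous (@cos R)} by apply: continuous_cos.
have csin x : {for x, continuous (- @sin R)}.
  by apply: continuousN; apply: continuous_sin.
rewrite -cB (@integration_by_substitution_decreasing R (@cos R)) //.
- apply: eq_integral => x _; congr EFin.
  by rewrite dcos !fctE /= opprK.
- by lra.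
- by rewrite dcos => x _; exact: csin.
- by rewrite dcos; apply: cvgP; apply/cvg_at_right_filter/csin.
- by rewrite dcos; apply: cvgP; apply/cvg_at_left_filter/csin.
- split; first by move=> x _; exact: derivable_cos.
  + exact/cvg_at_right_filter/ccos.
  + exact/cvg_at_left_filter/ccos.
- apply: continuous_in_subspaceT => x; rewrite inE/= in_itv/= cB.
  move=> /andP[x1 x2].
  apply: cG; rewrite in_itv/=.
  have h : cos e < 1.
    by rewrite -cos0 ltr_cos ?in_itv/=; try (apply/andP; split); lra.
  by apply/andP; split; lra.
Qed.

Lemma bigcup_segments (a b : R) (u v : nat -> R) :
  u @ \oo --> a -> v @ \oo --> b ->
  (forall n, a < u n) -> (forall n, v n < b) ->
  \bigcup_n `[u n, v n]%classic = `]a, b[%classic.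
Proof.
move=> ua vb au bv; apply/seteqP; split => x /=.
  by move=> [n _] /=; rewrite !in_itv/= => /andP[h1 h2];
    rewrite (lt_le_trans (au n)) //= (le_lt_trans h2).
rewrite in_itv/= => /andP[ax xb].
have [n [h1 h2]] : exists n, u n <= x /\ x <= v n.
  have /filter_ex [n [h1 h2]] : \forall n \near \oo, u n <= x /\ x <= v n.
    apply: filterI; first exact: (cvgr_le a) ua _ ax.
    exact: (cvgr_ge b) vb _ xb.
  by exists n.
by exists n => //=; rewrite in_itv/= h1 h2.
Qed.

(* [G] may be unbounded near [-1] and [1], so both intervals are exhausted by
   segments that avoid the endpoints. *)
Lemma ge0_integral_cos_subst (G : R -> R) :
  {in `]-1, 1[, continuous G} -> (forall x, 0 <= G x) ->
  (\int[mu]_(x in `[(-1)%R, 1%R]) (G x)%:E =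
   \int[mu]_(t in `[0%R, pi]) (G (cos t) * sin t)%:E)%E.
Proof.
move=> cG G0.
have p2 : 2 <= pi :> R by exact: pi_ge2.
pose e n : R := n.+1%:R^-1.
have e0 n : 0 < e n by rewrite invr_gt0 ltr0n.
have e1 n : e n <= 1 by rewrite invf_le1 ?ltr0n // ler1n.
have ecvg : e @ \oo --> (0 : R) by apply: cvg_harmonic.
have eS n : e n.+1 <= e n by rewrite lef_pV2 ?posrE ?ltr0n // ler_nat.
have mG : measurable_fun (`]-1, 1[%classic : set R) G.
  apply: open_continuous_measurable_fun; first exact: interval_open.
  by move=> x; rewrite inE/= => xI; exact: cG.
have sub t : t \in `]0, pi[ -> cos t \in `]-1, 1[.
  rewrite !in_itv/= => /andP[t0 tp]; rewrite -cospi -cos0.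
  by rewrite !ltr_cos ?in_itv/= ?tp ?t0 ?lexx ?ltW //; lra.
have cF : {in `]0, pi[, continuous (fun t => G (cos t) * sin t)}.
  move=> t tI; apply: continuousM; last exact: continuous_sin.
  apply: (@continuous_comp _ _ _ (@cos R) G); first exact: continuous_cos.
  by apply: cG; exact: sub.
have mF : measurable_fun (`]0, pi[%classic : set R)
    (fun t => G (cos t) * sin t).
  apply: open_continuous_measurable_fun; first exact: interval_open.
  by move=> x; rewrite inE/= => xI; exact: cF.
(* Endpoints are null sets, so both integrals pass to open intervals, which the segments below
   exhaust; monotone convergence then applies on each side. *)
rewrite integral_itv_bndoo; last exact/measurable_EFinP.
rewrite [RHS]integral_itv_bndoo; last exact/measurable_EFinP.
have cose n : cos (e n) < 1.
  rewrite -cos0 ltr_cos ?in_itv/= ?e0 //; have := e0 n; have := e1 n; lra.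
have UG : \bigcup_n `[- cos (e n), cos (e n)]%classic = `]-1, 1[%classic.
  have c : (fun n => cos (e n)) @ \oo --> (1 : R).
    rewrite -cos0; apply: continuous_cvg => //; exact: continuous_cos.
  apply: bigcup_segments => //; first exact: cvgN.
  by move=> n; rewrite ltrN2.
have UF : \bigcup_n `[e n, pi - e n]%classic = `]0, pi[%classic.
  apply: bigcup_segments => //; last by move=> n; rewrite ltrBlDr ltrDl.
  by rewrite -{2}[pi]subr0; apply: cvgB => //; exact: cvg_cst.
rewrite -UG -UF.
have cG1 :
    (\int[mu]_(x in `[(- cos (e n))%R, (cos (e n))%R]) (G x)%:E)%E
      @[n --> \oo] -->
    (\int[mu]_(x in \bigcup_n `[(- cos (e n))%R, (cos (e n))%R]%classic)
      (G x)%:E)%E.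
  apply: (@ge0_nondecreasing_set_cvg_integral _ (measurableTypeR R) R
    (fun n => `[- cos (e n), cos (e n)]%classic) (EFin \o G)) => //=.
  - apply/nondecreasing_seqP => n; apply/subsetPset => x /=; rewrite !in_itv/=.
    have : cos (e n) <= cos (e n.+1).
      rewrite leNgt ltr_cos -?leNgt ?eS // in_itv/= ltW //=.
        by apply: le_trans (e1 _) _; lra.
      by apply: le_trans (e1 _) _; lra.
    by move=> h /andP[h1 h2]; apply/andP; split; lra.
  - move=> n; apply/measurable_EFinP; rewrite -UG in mG;
    apply: measurable_funS mG => //=.
      exact: bigcupT_measurable.
    by move=> x xn; exists n.
  - by move=> n x _; rewrite lee_fin.
have cF1 :
    (\int[mu]_(x in `[(e n)%R, (pi - e n)%R]) (G (cos x) * sin x)%:E)%E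
      @[n --> \oo] -->
    (\int[mu]_(x in \bigcup_n `[(e n)%R, (pi - e n)%R]%classic)
      (G (cos x) * sin x)%:E)%E.
  apply: (@ge0_nondecreasing_set_cvg_integral _ (measurableTypeR R) R
    (fun n => `[e n, pi - e n]%classic)
    (EFin \o (fun t => G (cos t) * sin t))) => //=.
  - apply/nondecreasing_seqP => n; apply/subsetPset => x /=; rewrite !in_itv/=.
    by move=> /andP[h1 h2]; have := eS n; move=> h; apply/andP; split; lra.
  - move=> n; apply/measurable_EFinP; rewrite -UF in mF;
    apply: measurable_funS mF => //=.
      exact: bigcupT_measurable.
    by move=> x xn; exists n.
  - move=> n x; rewrite /= in_itv/= => /andP[x1 x2].
    rewrite lee_fin mulr_ge0 // sin_ge0_pi //; have := e0 n; move=> h;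
      apply/andP; split; lra.
apply: (cvg_unique _ cG1) => //.
rewrite (_ : (fun n => _) = fun n =>
  (\int[mu]_(t in `[e n, (pi - e n)%R]) (G (cos t) * sin t)%:E)%E) //.
by apply/funext => n; apply: integral_cos_subst_segment => //; have := e1 n;
  lra.
Qed.

(** The nonnegative case applies to the positive and negative parts of [G] separately: [sin] is
    nonnegative on [[0, pi]], so multiplying by it commutes with taking these parts. *)
Lemma integral_cos_subst (G : R -> R) :
  {in `]-1, 1[, continuous G} ->
  \int[mu]_(x in `[-1, 1]) G x = \int[mu]_(t in `[0, pi]) (G (cos t) * sin t).
Proof.
move=> cG; congr fine; rewrite integralE [RHS]integralE.
have s0 (t : R) : t \in (`[0, pi]%classic : set R) -> 0 <= sin t.
  by rewrite inE/= in_itv/= => h; exact: sin_ge0_pi.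
congr (_ - _)%E.
- transitivity (\int[mu]_(x in `[(-1)%R, 1%R]) (Num.max (G x) 0)%:E)%E.
    by apply: eq_integral => x _; rewrite funeposE EFin_max.
  rewrite ge0_integral_cos_subst.
  + by apply: eq_integral => t /s0 h; rewrite funeposE -EFin_max maxr_pMl //
    mul0r.
  + move=> x /cG h; apply: continuous_max => //; exact: cst_continuous.
  + by move=> x; rewrite le_max lexx orbT.
- transitivity (\int[mu]_(x in `[(-1)%R, 1%R]) (Num.max (- G x) 0)%:E)%E.
    by apply: eq_integral => x _; rewrite funenegE EFin_max EFinN.
  rewrite ge0_integral_cos_subst.
  + by apply: eq_integral => t /s0 h; rewrite funenegE -EFinN -EFin_max
    maxr_pMl // mul0r mulNr.
  + move=> x /cG h; apply: (@continuous_max R R (- G) (cst 0));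
    [exact: continuousN | exact: cst_continuous].
  + by move=> x; rewrite le_max lexx orbT.
Qed.

End CosSubstitution.

(** * Cosine moments of phi *)

Section Moments.
Variable R : realType.
Local Notation mu := (@lebesgue_measure R).

Lemma continuous_integrable_segment (f : R -> R) (a b : R) : continuous f ->
  mu.-integrable `[a, b] (EFin \o f).
Proof.
move=> cf; apply: continuous_compact_integrable; first exact: segment_compact.
exact: continuous_subspaceT.
Qed.

Lemma continuous_cosM (a : R) : continuous (fun t : R => cos (a * t)).
Proof.
move=> t; apply: (@continuous_comp _ _ _ ( *%R a) (@cos R)).
  exact: mulrl_continuous.
exact: continuous_cos.
Qed.

(** For positive [k] the primitive [sin (k t) / k] vanishes at both [0] and [pi]. *)
Lemma Rintegral_cosM (k : nat) :
  \int[mu]_(t in `[0, pi]) cos (k%:R * t) = if k == 0%N then pi else 0.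
Proof.
have p0 : 0 < pi :> R by exact: pi_gt0.
case: eqP => [->|/eqP k0].
  under eq_Rintegral do rewrite mul0r cos0.
  by rewrite Rintegral_cst //= (lebesgue_measure_itv `[0, pi]) /= lte_fin p0
    -EFinD /= mul1r subr0.
have kR : k%:R != 0 :> R by rewrite pnatr_eq0.
have dF (t : R) : is_derive t (1 : R)
    (fun t : R => k%:R^-1 * sin (k%:R * t)) (cos (k%:R * t)).
  apply: is_derive_eq.
  by rewrite !scaler1 /GRing.scale /=; field.
rewrite /Rintegral
  (@continuous_FTC2 _ _ (fun t : R => k%:R^-1 * sin (k%:R * t)) _ _ p0).
- rewrite -EFinB /= mulr0 sin0 mulr0 subr0.
  suff -> : sin (k%:R * pi) = 0 :> R by rewrite mulr0.
  elim: k {k0 kR dF} => [|k IH]; first by rewrite mul0r sin0.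
  by rewrite -natr1 mulrDl mul1r sinDpi IH oppr0.
- exact/continuous_subspaceT/continuous_cosM.
- have cF : continuous (fun t : R => k%:R^-1 * sin (k%:R * t)).
    by move=> t; apply/differentiable_continuous/derivable1_diffP.
  split; [by [] | exact/cvg_at_right_filter/cF | exact/cvg_at_left_filter/cF].
- by move=> t _; rewrite derive1E derive_val.
Qed.

Variable q : R.
Hypotheses (q0 : 0 < q) (q1 : q < 1).

Lemma poisson_denom_gt0 (x : R) : x <= 1 -> 0 < 1 + q ^+ 2 - 2 * q * x.
Proof.
move=> x1; rewrite (_ : _ - _ = (1 - q) ^+ 2 + 2 * q * (1 - x)); last by ring.
by rewrite ltr_pwDl ?exprn_gt0 ?subr_gt0 // !mulr_ge0 ?subr_ge0 // ltW.
Qed.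

(** With [alpha = 2q/(1-q)] one has [alpha + alpha^2/2 = 2q/(1-q)^2], which exposes the Poisson
    denominator. *)
Lemma phiE (x : R) : x <= 1 ->
  phi q x = (1 - q) ^+ 2 / (1 + q ^+ 2 - 2 * q * x).
Proof.
move=> /poisson_denom_gt0 d0; rewrite /phi -[RHS]invrK invf_div; congr _^-1.
by field; rewrite subr_eq0 gt_eqF.
Qed.

Lemma phi_ge0 (x : R) : x <= 1 -> 0 <= phi q x.
Proof.
move=> x1; rewrite phiE // divr_ge0 ?sqr_ge0 // ltW //;
  exact: poisson_denom_gt0.
Qed.

Lemma continuous_phi (x : R) : x <= 1 -> {for x, continuous (phi q)}.
Proof.
move=> /poisson_denom_gt0 d0.
rewrite /phi; apply: continuousV; last first.
  apply: continuousD; first apply: continuousD; first exact: cst_continuous.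
    apply: continuousM; first exact: cst_continuous.
    by apply: continuousB; [exact: cst_continuous|].
  apply: continuousM; first exact: cst_continuous.
  by apply: continuousB; [exact: cst_continuous|].
rewrite (_ : _ + _ = (1 + q ^+ 2 - 2 * q * x) / (1 - q) ^+ 2).
  by rewrite gt_eqF // divr_gt0 // exprn_gt0 // subr_gt0.
by field; rewrite subr_eq0 gt_eqF.
Qed.

Lemma continuous_phi_cos : continuous (fun t => phi q (cos t)).
Proof.
move=> t; apply: (@continuous_comp _ _ _ (@cos R) (phi q));
  first exact: continuous_cos.
by apply: continuous_phi; exact: cos_le1.
Qed.

Definition poisson_moment (k : nat) : R :=
  \int[mu]_(t in `[0, pi]) (cos (k%:R * t) * phi q (cos t)).

Lemma continuous_moment (a : R) :
  continuous (fun t : R => cos (a * t) * phi q (cos t)).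
Proof.
by move=> t; apply: cvgM; [exact: continuous_cosM|exact: continuous_phi_cos].
Qed.

(* Both recurrences integrate, against [cos (k t)], the identity
   [phi q (cos t) * (1 + q^2 - 2 q cos t) = (1 - q)^2]. *)
Lemma poisson_moment_rec0 :
  (1 + q ^+ 2) * poisson_moment 0 - 2 * q * poisson_moment 1
  = (1 - q) ^+ 2 * pi.
Proof.
transitivity ((1 - q) ^+ 2 * \int[mu]_(t in `[0, pi]) cos (0%:R * t));
  last first.
  by rewrite (Rintegral_cosM 0).
rewrite /poisson_moment -!RintegralZl //; try
  exact/continuous_integrable_segment/continuous_moment;
  try exact/continuous_integrable_segment/continuous_cosM.
rewrite -RintegralB //; first last.
- by apply: continuous_integrable_segment => t; apply: cvgM;
  [exact: cvg_cst|exact: continuous_moment].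
- by apply: continuous_integrable_segment => t; apply: cvgM;
  [exact: cvg_cst|exact: continuous_moment].
apply: eq_Rintegral => t _; rewrite !mul0r cos0 !mul1r phiE ?cos_le1 //.
by field; rewrite gt_eqF // poisson_denom_gt0 // cos_le1.
Qed.

Lemma poisson_moment_rec (k : nat) :
  (1 + q ^+ 2) * poisson_moment k.+1 =
    q * poisson_moment k + q * poisson_moment k.+2.
Proof.
apply/eqP; rewrite -subr_eq0; apply/eqP.
transitivity ((1 - q) ^+ 2 * \int[mu]_(t in `[0, pi]) cos (k.+1%:R * t));
  last first.
  by rewrite Rintegral_cosM mulr0.
have cM (a : R) k' :
    continuous (fun t : R => a * (cos (k'%:R * t) * phi q (cos t))).
  by move=> t; apply: cvgM; [exact: cvg_cst|exact: continuous_moment].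
rewrite /poisson_moment -!RintegralZl //; try
  exact/continuous_integrable_segment/continuous_moment;
  try exact/continuous_integrable_segment/continuous_cosM.
rewrite -RintegralD //; try exact/continuous_integrable_segment/cM.
rewrite -RintegralB //; try exact/continuous_integrable_segment/cM; last first.
  apply: continuous_integrable_segment => t; apply: cvgD; exact: cM.
apply: eq_Rintegral => t _; rewrite phiE ?cos_le1 //.
(* Centering at [k.+1] gives [cos ((k+2)t) + cos (kt) = 2 cos t cos ((k+1)t)]. *)
have -> : k.+2%:R * t = k.+1%:R * t + t by rewrite -natr1; ring.
have -> : k%:R * t = k.+1%:R * t - t by rewrite -natr1; ring.
rewrite cosB cosD.
by field; rewrite gt_eqF // poisson_denom_gt0 // cos_le1.
Qed.

(** Since [phi] is nonnegative, this is [|cos| <= 1] under the integral. It excludes the solution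
    [q^(-k)] of the recurrence. *)
Lemma poisson_moment_bounded (k : nat) :
  `|poisson_moment k| <= poisson_moment 0.
Proof.
have i k' := continuous_integrable_segment _ 0 pi (continuous_moment k'%:R).
apply: le_trans (le_normr_Rintegral _ (i k)) _ => //.
apply: le_Rintegral => //.
  apply: continuous_integrable_segment => t.
  by apply: cvg_norm; exact: continuous_moment.
move=> t _; rewrite mul0r cos0 mul1r normrM.
by rewrite (ger0_norm (phi_ge0 _ (cos_le1 t))) ler_piMl ?phi_ge0 ?cos_le1
  ?cos_max.
Qed.

Lemma poisson_momentE (k : nat) :
  poisson_moment k = pi * ((1 - q) / (1 + q)) * q ^+ k.
Proof.
(* [D] is geometric of ratio [1/q > 1], hence zero as the moments are bounded. *)
pose D k := poisson_moment k.+1 - q * poisson_moment k.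
have DS j : q ^+ j * D j = D 0%N.
  elim: j => [|j IH]; first by rewrite mul1r.
  rewrite -IH exprSr -mulrA; congr (_ * _).
  have := poisson_moment_rec j; rewrite /D => h.
  move: (poisson_moment _) (poisson_moment _) (poisson_moment _) h => u v w h.
  by apply/eqP; rewrite -subr_eq0; apply/eqP;
    rewrite -[RHS](subrr (q * v + q * u)) -{2}h; ring.
have D0 : D 0%N = 0.
  pose B := poisson_moment 0 + q * poisson_moment 0.
  have bD j : `|D j| <= B.
    apply: le_trans (ler_normB _ _) _; apply: lerD;
      first exact: poisson_moment_bounded.
    by rewrite normrM (gtr0_norm q0) ler_pM2l // poisson_moment_bounded.
  have cv : (fun j => q ^+ j * B) @ \oo --> 0 * B.
    by apply: cvgMl; apply: cvg_expr; rewrite gtr0_norm.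
  (* Otherwise [q ^+ j * B] eventually drops below [|D 0|], which equals [q ^+ j * |D j|]. *)
  apply/eqP; rewrite -normr_le0 -(mul0r B) leNgt; apply/negP => h.
  have /filter_ex [j] : \forall j \near \oo, q ^+ j * B < `|D 0%N|.
    exact: (cvgr_lt (0 * B)) cv _ h.
  rewrite -(DS j) normrM normrX (gtr0_norm q0) ltr_pM2l ?exprn_gt0 //.
  by rewrite ltNge bD.
have M k' : poisson_moment k' = poisson_moment 0 * q ^+ k'.
  elim: k' => [|j IH]; first by rewrite mulr1.
  have : D j = 0.
    by apply/eqP; have /eqP := DS j; rewrite D0 mulf_eq0 expf_eq0 gt_eqF //
      andbF.
  by move=> /eqP; rewrite subr_eq0 => /eqP ->; rewrite IH exprS; ring.
rewrite M; congr (_ * _).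
(* The initial relation now reads [(1 - q^2) M_0 = (1 - q)^2 pi] and fixes the constant. *)
have := poisson_moment_rec0; rewrite (M 1%N) expr1 => h.
have q2 : 1 - q ^+ 2 != 0 by rewrite gt_eqF // subr_gt0 exprn_ilt1 // ltW.
apply: (mulfI q2); transitivity ((1 - q) ^+ 2 * pi); first by rewrite -h; ring.
by field; rewrite gt_eqF // addr_gt0.
Qed.

End Moments.

(** * Jacobi polynomials at cos t and their inner products *)

Section JacobiTrig.
Variable R : realType.

(** This is [exp(it)], the value given to [z] in [jacobi_spec], and to the square root [w] of [z] at
    half the angle. *)
Definition cis (t : R) : R[i] := Complex (cos t) (sin t).

Lemma cisD (s t : R) : cis (s + t) = cis s * cis t.
Proof. by rewrite /cis cosD sinD [RHS]/GRing.mul /= [sin s * _ + _]addrC. Qed.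

Lemma cis0 : cis 0 = 1.
Proof. by rewrite /cis cos0 sin0. Qed.

Lemma cis_neq0 (t : R) : cis t != 0.
Proof.
apply/eqP => h; have := cisD t (- t); rewrite subrr cis0 h mul0r => /eqP.
by rewrite oner_eq0.
Qed.

Lemma cisN (t : R) : cis (- t) = (cis t)^-1.
Proof.
by apply: (mulfI (cis_neq0 t)); rewrite -cisD subrr cis0 divff // cis_neq0.
Qed.

Lemma cisX (n : nat) (t : R) : cis t ^+ n = cis (n%:R * t).
Proof.
elim: n => [|n IH]; first by rewrite mul0r cis0.
by rewrite exprS IH -cisD -natr1 mulrDl mul1r addrC.
Qed.

Lemma cis_addN (t : R) : cis t + cis (- t) = real_complex R (2 * cos t).
Proof.
by rewrite /cis cosN sinN [LHS]/GRing.add /= subrr mulr2n mulrDl mul1r.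
Qed.

Lemma cis_subN (t : R) : cis t - cis (- t) = Complex 0 (2 * sin t).
Proof.
rewrite /cis cosN sinN; simpc.
by rewrite mulr2n mulrDl mul1r.
Qed.

(** At [z = exp(it)] both differences in [jacobi_spec] are purely imaginary; comparing imaginary
    parts gives the identity, and [sin t != 0] says that [z - z^-1] is nonzero. *)
Lemma jacobi_sin (n : nat) (t : R) : sin t != 0 ->
  (jacobi n (2^-1 : R)).[cos t] * sin t = sin (n.+1%:R * t).
Proof.
move=> s0; have [/(_ erefl (cis t) (cis_neq0 t)) + _] :=
  @jacobiP R _ n (or_introl erefl).
have hz : cis t - (cis t)^-1 != 0.
  by rewrite -cisN cis_subN eq_complex /= eqxx /= mulf_neq0 ?pnatr_eq0.
move=> /(_ hz); rewrite -cisN cis_addN cis_subN.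
rewrite -exprVn -cisN !cisX mulrN cis_subN.
have -> : real_complex R (2 * cos t) / 2 = real_complex R (cos t).
  by rewrite rmorphM /= rmorph_nat mulrC mulKf // pnatr_eq0.
rewrite horner_map /= => /(congr1 ( *%R^~ (Complex 0 (2 * sin t)))).
rewrite divfK; last by rewrite -cis_subN cisN.
simpc => -[]; rewrite mulrCA; apply: mulfI; by rewrite pnatr_eq0.
Qed.

Lemma jacobi_cos (n : nat) (t : R) : cos (t / 2) != 0 ->
  (jacobi n (- 2^-1 : R)).[cos t] * cos (t / 2)
  = cos ((2 * n + 1)%:R * (t / 2)).
Proof.
move=> c0; have [_ /(_ erefl (cis (t / 2)) (cis_neq0 _))] :=
  @jacobiP R _ n (or_intror erefl).
rewrite -!exprVn -cisN cis_addN !cisX !mulrN !cis_addN.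
have c2 : real_complex R (2 * cos (t / 2)) != 0.
  by rewrite eq_complex /= eqxx andbT mulf_neq0 ?pnatr_eq0.
have -> : real_complex R (2 * cos (2 * (t / 2))) / 2 = real_complex R (cos t).
  rewrite rmorphM /= rmorph_nat mulrC mulKf ?pnatr_eq0 //.
  by rewrite mulrC divfK // pnatr_eq0.
move=> /(_ c2); rewrite horner_map /= -fmorph_div /= => /complexI ->.
by field; rewrite c0.
Qed.

End JacobiTrig.

Section Inner.
Variable R : realType.
Local Notation mu := (@lebesgue_measure R).

(** The trigonometric form of the integrands is available only where [sin t] or [cos (t / 2)] is
    nonzero, hence agreement on the open interval. Measurability of [f] there is inherited from
    [g]. *)
Lemma eq_Rintegral_itvoo (f g : R -> R) (a b : R) : continuous g ->
  {in `]a, b[, f =1 g} ->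
  \int[mu]_(x in `[a, b]) f x = \int[mu]_(x in `[a, b]) g x.
Proof.
move=> cg fg; congr fine.
have mg : measurable_fun (`]a, b[%classic : set R) g.
  apply: subspace_continuous_measurable_fun => //; exact: continuous_subspaceT.
have mf : measurable_fun (`]a, b[%classic : set R) f.
  by apply: eq_measurable_fun mg => x; rewrite inE/= => /fg.
rewrite integral_itv_bndoo; last exact/measurable_EFinP.
rewrite [RHS]integral_itv_bndoo; last exact/measurable_EFinP.
by apply: eq_integral => x; rewrite inE/= => /fg ->.
Qed.

Lemma cos_distn (m n : nat) (t : R) :
  cos (`|m%:Z - n%:Z|%N%:R * t) = cos (m%:R * t - n%:R * t).
Proof.
have [mn|/ltnW nm] := leqP m n.
  by rewrite distnEr // natrB // mulrBl -cosN opprB.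
by rewrite distnEl // natrB // mulrBl.
Qed.

Lemma sin_sqrt (t : R) : 0 <= t <= pi ->
  sin t = Num.sqrt (1 - cos t) * Num.sqrt (1 + cos t).
Proof.
move=> t0p; rewrite -sqrtrM ?subr_ge0 ?cos_le1 //.
have -> : (1 - cos t) * (1 + cos t) = sin t ^+ 2 by rewrite sin2cos2; ring.
by rewrite sqrtr_sqr ger0_norm // sin_ge0_pi.
Qed.

Variable q : R.
Hypotheses (q0 : 0 < q) (q1 : q < 1).

(** The sign [e = -1] serves products of sines and [e = 1] products of cosines. *)
Lemma Rintegral_moment_add (e : R) (j k : nat) :
  \int[mu]_(t in `[0, pi])
    ((cos (j%:R * t) + e * cos (k%:R * t)) * phi q (cos t))
  = pi * ((1 - q) / (1 + q) * (q ^+ j + e * q ^+ k)).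
Proof.
have i l : mu.-integrable `[0, pi]
    (EFin \o fun t : R => cos (l%:R * t) * phi q (cos t)).
  by apply: continuous_integrable_segment; exact: continuous_moment.
transitivity (\int[mu]_(t in `[0, pi])
   (cos (j%:R * t) * phi q (cos t) + e * (cos (k%:R * t) * phi q (cos t)))).
  by apply: eq_Rintegral => t _; ring.
rewrite RintegralD //; last first.
  apply: continuous_integrable_segment => t.
  by apply: cvgM; [exact: cvg_cst|exact: continuous_moment].
rewrite RintegralZl // -!/(poisson_moment _ _ _) !poisson_momentE //; ring.
Qed.

Lemma continuous_moment_add (e a b : R) :
  continuous (fun t : R => (cos (a * t) + e * cos (b * t)) * phi q (cos t)).
Proof.
move=> t; apply: cvgM; last exact: continuous_phi_cos.
apply: cvgD; first exact: continuous_cosM.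
by apply: cvgM; [exact: cvg_cst|exact: continuous_cosM].
Qed.

Lemma continuous_weightD (x : R) :
  {for x, continuous (fun x : R => Num.sqrt (1 + x))}.
Proof.
apply: (@continuous_comp _ _ _ (fun x : R => 1 + x) Num.sqrt);
  last exact: sqrt_continuous.
by apply: continuousD => //; exact: cst_continuous.
Qed.

Lemma continuous_weightB (x : R) :
  {for x, continuous (fun x : R => Num.sqrt (1 - x))}.
Proof.
apply: (@continuous_comp _ _ _ (fun x : R => 1 - x) Num.sqrt);
  last exact: sqrt_continuous.
by apply: continuousB => //; exact: cst_continuous.
Qed.

(** The weight and the Jacobian each contribute [sin t]; together they cancel the two denominators
    and leave [sin ((m+1)t) sin ((n+1)t)], half a difference of cosines. *)
Lemma inner_jacobi_half (m n : nat) :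
  inner 2^-1 (fun x => (jacobi m 2^-1).[x])
             (fun x => (jacobi n 2^-1).[x] * phi q x)
  = (1 - q) / (1 + q) * (q ^+ `|m%:Z - n%:Z|%N - q ^+ (m + n + 2)).
Proof.
have p0 : 0 < pi :> R by exact: pi_gt0.
rewrite /inner.
have -> : 2 `^ (2^-1 + 2^-1) = 2 :> R.
  by rewrite -[X in _ `^ (X + X)]div1r -splitr powRr1.
set J := fun n x => (jacobi n (2^-1 : R)).[x].
transitivity (2 / pi * \int[mu]_(x in `[-1, 1])
   (J m x * J n x * phi q x * Num.sqrt (1 - x) * Num.sqrt (1 + x))).
  congr (_ * _); apply: eq_Rintegral => x;
    rewrite inE/= in_itv/= => /andP[x1 x2].
  by rewrite !powR12_sqrt ?subr_ge0 //; [rewrite !mulrA | lra].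
rewrite integral_cos_subst; last first.
  move=> x; rewrite in_itv/= => /andP[x1 x2].
  apply: cvgM; last exact: continuous_weightD.
  apply: cvgM; last exact: continuous_weightB.
  apply: cvgM; last exact/continuous_phi/ltW.
  by apply: cvgM; exact: continuous_horner.
rewrite (@eq_Rintegral_itvoo _ (fun t => 2^-1 *
  ((cos (`|m%:Z - n%:Z|%N%:R * t) + (-1) * cos ((m + n + 2)%:R * t))
   * phi q (cos t)))).
- rewrite RintegralZl //;
    last exact/continuous_integrable_segment/continuous_moment_add.
  rewrite Rintegral_moment_add // mulN1r.
  by move: (@pi R) (_ / (1 + q)) p0 => p c p0; field; rewrite gt_eqF.
- by move=> t; apply: cvgM; [exact: cvg_cst|exact: continuous_moment_add].
- move=> t; rewrite in_itv/= => /andP[t0 tp].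
  have s0 : sin t != 0 by rewrite gt_eqF // sin_gt0_pi // t0.
  rewrite cos_distn.
  have -> : (m + n + 2)%:R * t = m.+1%:R * t + n.+1%:R * t.
    by rewrite -!natr1 !natrD; ring.
  have -> : m%:R * t - n%:R * t = m.+1%:R * t - n.+1%:R * t.
    by rewrite -!natr1; ring.
  rewrite cosB cosD -!jacobi_sin // -/(J m _) -/(J n _).
  rewrite -[_ * Num.sqrt (1 - _) * _]mulrA -sin_sqrt ?ltW //; by field.
Qed.

(** Here weight times Jacobian is [1 + cos t = 2 cos^2 (t/2)], which cancels the denominators
    [cos (t/2)]. The remaining frequencies [m + 1/2] and [n + 1/2] have sum [m + n + 1] and
    difference [m - n]. *)
Lemma inner_jacobi_Nhalf (m n : nat) :
  inner (- 2^-1) (fun x => (jacobi m (- 2^-1)).[x])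
                 (fun x => (jacobi n (- 2^-1)).[x] * phi q x)
  = Rker q m n.
Proof.
have p0 : 0 < pi :> R by exact: pi_gt0.
rewrite /inner.
have -> : 2 `^ (- 2^-1 + 2^-1) = 1 :> R by rewrite addNr powRr0.
set J := fun n x => (jacobi n (- 2^-1 : R)).[x].
transitivity (1 / pi * \int[mu]_(x in `[-1, 1])
   (J m x * J n x * phi q x * (Num.sqrt (1 - x))^-1 * Num.sqrt (1 + x))).
  congr (_ * _); apply: eq_Rintegral => x;
    rewrite inE/= in_itv/= => /andP[x1 x2].
  by rewrite powRN !powR12_sqrt ?subr_ge0 //; [rewrite !mulrA | lra].
rewrite integral_cos_subst; last first.
  move=> x; rewrite in_itv/= => /andP[x1 x2].
  apply: cvgM; last exact: continuous_weightD.
  apply: cvgM.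
    apply: cvgM; last exact/continuous_phi/ltW.
    by apply: cvgM; exact: continuous_horner.
  apply: cvgV; last exact: continuous_weightB.
  by rewrite gt_eqF // sqrtr_gt0 subr_gt0.
rewrite (@eq_Rintegral_itvoo _ (fun t =>
  ((cos (`|m%:Z - n%:Z|%N%:R * t) + 1 * cos ((m + n + 1)%:R * t))
   * phi q (cos t)))).
- by rewrite Rintegral_moment_add // /Rker !mul1r mulKf // gt_eqF.
- exact: continuous_moment_add.
- move=> t; rewrite in_itv/= => /andP[t0 tp].
  have c0 : cos (t / 2) != 0.
    by rewrite gt_eqF // cos_gt0_pihalf //; apply/andP; split; lra.
  rewrite cos_distn mul1r.
  have -> : (m + n + 1)%:R * t
      = (2 * m + 1)%:R * (t / 2) + (2 * n + 1)%:R * (t / 2).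
    by rewrite !(natrD _ _ 1) !natrM ?natrD; field.
  have -> : m%:R * t - n%:R * t
      = (2 * m + 1)%:R * (t / 2) - (2 * n + 1)%:R * (t / 2).
    by rewrite !(natrD _ _ 1) !natrM ?natrD; field.
  rewrite cosB cosD -!jacobi_cos // -/(J m _) -/(J n _).
  rewrite sin_sqrt; last by rewrite !ltW.
  have cc : Num.sqrt (1 + cos t) ^+ 2 = 2 * cos (t / 2) ^+ 2.
    rewrite sqr_sqrtr; last by have := cos_geN1 t; lra.
    have := cos_mulr2n (t / 2); rewrite -[_ / 2 *+ 2]mulr_natr divfK // => ->.
    by rewrite mulr2n; ring.
  transitivity (J m (cos t) * J n (cos t) * phi q (cos t)
    * Num.sqrt (1 + cos t) ^+ 2).
    field; rewrite gt_eqF // sqrtr_gt0 subr_gt0 -cos0.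
    by rewrite ltr_cos ?in_itv/= ?lexx ?ltW.
  by rewrite cc; ring.
Qed.

End Inner.

(** * Determinants over ordered blocks *)

Section BlockDeterminant.

Lemma perm_incr_ge (n : nat) (u : 'S_n) :
  (forall i j : 'I_n, (i < j)%N -> (u i < u j)%N) ->
  forall i : 'I_n, (i <= u i)%N.
Proof.
move=> uI; case=> k; elim: k => [//|k IH] kn /=.
apply: leq_ltn_trans (IH (ltnW kn)) _.
exact: uI (Ordinal (ltnW kn)) (Ordinal kn) _.
Qed.

(** The inverse of [u] is increasing too, and an increasing permutation moves no index down; applied
    to both, this leaves every index fixed. *)
Lemma perm_incr_id (n : nat) (u : 'S_n) :
  (forall i j : 'I_n, (i < j)%N -> (u i < u j)%N) -> u = 1%g.
Proof.
move=> uI; have vI (i j : 'I_n) : (i < j)%N -> ((u^-1)%g i < (u^-1)%g j)%N.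
  move=> ij; rewrite ltnNge leq_eqVlt.
  apply/negP => /orP[/eqP/val_inj/perm_inj ji|/uI].
    by rewrite ji ltnn in ij.
  by rewrite !permKV ltnNge ltnW.
apply/permP => i; apply/val_inj/eqP; rewrite perm1 eqn_leq perm_incr_ge // andbT.
by have := @perm_incr_ge _ _ vI (u i); rewrite permK.
Qed.

Variables (R : comNzRingType) (q : R).

(** The indicator is essential: for [c > x] truncated subtraction alone would give the value 1. *)
Definition trunc_pow (x c : nat) : R := q ^+ (x - c) *+ (c <= x)%N.

(** The last block has no lower bound and reaches down to 0. *)
Definition in_block (n : nat) (x : nat -> nat) (i c : nat) : bool :=
  (c <= x i)%N && ((i.+1 < n)%N ==> (x i.+1 < c)%N).

Definition decreasing_upto (n : nat) (x : nat -> nat) : Prop :=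
  forall i j : nat, (i < j)%N -> (j < n)%N -> (x j < x i)%N.

Variables (n N : nat) (w : nat -> R).

(** The chain is [d <= x j <= x i.+1 < c]; row [i] is not the last, so its lower bound is active. *)
Lemma in_block_lt (x : nat -> nat) (i j c d : nat) : decreasing_upto n x ->
  (i < j)%N -> (j < n)%N -> in_block n x i c -> in_block n x j d -> (d < c)%N.
Proof.
move=> xD ij jn /andP[_ /implyP h] /andP[dx _].
apply: leq_ltn_trans dx (leq_ltn_trans _ (h (leq_ltn_trans ij jn))).
move: ij; rewrite leq_eqVlt => /predU1P[->//|ij].
exact/ltnW/xD.
Qed.

(* A permutation contributes only if every block [i] of [x] meets the block
   [u i] of [y]; the blocks being ordered, [u] is then increasing. *)
Lemma det_blocks (x y : nat -> nat) (f : nat -> nat -> nat -> R) :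
    decreasing_upto n x -> decreasing_upto n y ->
  \det (\matrix_(i < n, j < n)
     \sum_(c < N | in_block n x i c && in_block n y j c) f i j c)
  = \prod_(i < n) \sum_(c < N | in_block n x i c && in_block n y i c) f i i c.
Proof.
move=> xD yD; rewrite /determinant (bigD1 1%g) //= [X in _ + X]big1 ?addr0.
  rewrite odd_perm1 expr0 mul1r.
  by apply: eq_bigr => i _; rewrite mxE perm1.
move=> u u1.
pose P (i : 'I_n) :=
  [forall c : 'I_N, ~~ (in_block n x i c && in_block n y (u i) c)].
(* If some block of [x] misses its partner in [y], that factor is an empty sum and the whole term
   vanishes. *)
have [i /forallP hi|h] := pickP P.
  rewrite (bigD1 i) //= mxE big1 ?mul0r ?mulr0 // => c cb.
  by have := hi c; rewrite cb.
have {}h (i : 'I_n) : exists c : 'I_N, in_block n x i c && in_block n y (u i) c.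
  have /negbT := h i; rewrite negb_forall => /existsP[c]; rewrite negbK => hc.
  by exists c.
case/eqP: u1; apply: perm_incr_id => i j ij.
have [[c /andP[xc yc]] [d /andP[xd yd]]] := (h i, h j).
have dc := in_block_lt _ _ _ _ _ xD ij (ltn_ord j) xc xd.
rewrite ltnNge leq_eqVlt; apply/negP => /orP[/eqP/val_inj/perm_inj ji|ji].
  by rewrite ji ltnn in ij.
have := in_block_lt _ _ _ _ _ yD ji (ltn_ord _) yd yc.
by rewrite ltnNge ltnW.
Qed.

(** The matrix factors as [A x *m D *m (A y)^T] with [D] diagonal. The unitriangular [U x] and [U y]
    turn [A] into the block-supported [B] on both sides without changing the determinant, so
    [det_blocks] applies. *)
Lemma det_trunc_pow (x y : nat -> nat) :
    decreasing_upto n x -> decreasing_upto n y ->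
  \det (\matrix_(i < n, j < n)
     \sum_(c < N) w c * (trunc_pow (x i) c * trunc_pow (y j) c))
  = \prod_(i < n) \sum_(c < N | in_block n x i c && in_block n y i c)
      w c * (q ^+ (x i - c) * q ^+ (y i - c)).
Proof.
move=> xD yD.
pose A z : 'M[R]_(n, N) := \matrix_(i, c) trunc_pow (z i) c.
pose B (z : nat -> nat) : 'M[R]_(n, N) :=
  \matrix_(i, c) (q ^+ (z i - c) *+ in_block n z i c).
(* Left multiplication by [U z] subtracts [q ^+ (z i - z i.+1)] times row
   [i.+1] from row [i], which cuts [trunc_pow (z i)] down to block [i]. *)
pose U (z : nat -> nat) : 'M[R]_n :=
  \matrix_(i, j) ((i == j)%:R - q ^+ (z i - z j) *+ (j == i.+1 :> nat)).
have detU z : \det (U z) = 1.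
  rewrite -det_tr det_trig.
    apply: big1 => i _; rewrite !mxE eqxx (_ : (_ == _) = false) ?subr0 //.
    by apply/negbTE; rewrite neq_ltn ltnSn.
  apply/is_trig_mxP => i j ij; rewrite !mxE -[j == i]val_eqE /=.
  by rewrite gtn_eqF // ltn_eqF ?subr0 // ltnW.
have UA z : decreasing_upto n z -> U z *m A z = B z.
  move=> zD; apply/matrixP => i c; rewrite !mxE.
  under eq_bigr => j _ do rewrite !mxE mulrBl.
  rewrite sumrB (bigD1 i) //= eqxx mul1r big1 ?addr0; last first.
    by move=> j /negbTE ji; rewrite eq_sym ji mul0r.
  rewrite /trunc_pow /in_block.
  have [iN|iN] := ltnP i.+1 n; last first.
    rewrite big1 ?subr0 ?andbT // => j _.
    by rewrite (_ : (_ == _) = false) ?mul0r //; apply/negbTE;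
      have := ltn_ord j; lia.
  rewrite (bigD1 (Ordinal iN)) //= eqxx big1 ?addr0; last first.
    move=> j ji; rewrite (_ : (_ == _) = false) ?mul0r //.
    by apply: contraNF ji => ji; rewrite -val_eqE.
  have := zD i i.+1 (ltnSn _) iN => zi.
  (* Up to [z i.+1] the two powers cancel exactly; above it the subtracted entry is already 0. *)
  have [cz|cz] := leqP c (z i.+1).
    have cz' : (c <= z i)%N by lia.
    rewrite cz' /= mulr1n -exprD.
    by rewrite (_ : (_ - _ + _)%N = (z i - c)%N) ?subrr //; lia.
  by rewrite !mulr0n mulr0 subr0 andbT.
pose D : 'M[R]_N := diag_mx (\row_c w c).
rewrite (_ : \matrix_(_, _) _ = A x *m D *m (A y)^T); last first.
  apply/matrixP => i j; rewrite !mxE; apply: eq_bigr => c _.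
  by rewrite mul_mx_diag !mxE; ring.
transitivity (\det (B x *m D *m (B y)^T)).
  rewrite -!UA // trmx_mul.
  by rewrite !mulmxA det_mulmx det_tr detU mulr1 -!mulmxA det_mulmx detU mul1r.
rewrite -(det_blocks _ _
  (fun i j c => w c * (q ^+ (x i - c) * q ^+ (y j - c)))) //.
congr (\det _); apply/matrixP => i j; rewrite !mxE.
rewrite [RHS]big_mkcond; apply: eq_bigr => c _; rewrite mul_mx_diag !mxE.
by case: (in_block n x i c) (in_block n y j c) => -[];
  rewrite /= ?mulr1n ?mulr0n; ring.
Qed.

End BlockDeterminant.

(** * Sums over interlacing sequences *)

Section Interlacing.

Definition between (n : nat) (l : seq nat) (i c : nat) : bool :=
  (c <= nth 0 l i)%N && ((i.+1 < n)%N ==> (nth 0 l i.+1 <= c)%N).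

Lemma sorted_geq_nth (l : seq nat) (i j : nat) : sorted geq l ->
  (i <= j)%N -> (j < size l)%N -> (nth 0 l j <= nth 0 l i)%N.
Proof.
move=> sl ij jl; apply: (sorted_leq_nth _ _ 0%N sl) => //; rewrite ?inE //.
- by move=> x y z /= xy yz; exact: leq_trans yz xy.
- exact: leqnn.
- exact: leq_ltn_trans jl.
Qed.

Lemma shifted_decreasing (l : seq nat) : sorted geq l ->
  decreasing_upto (size l) (shifted l).
Proof.
move=> sl i j ij jl; rewrite /shifted.
by have := sorted_geq_nth _ _ _ sl (ltnW ij) jl; lia.
Qed.

(** Row [i] is shifted by one more than row [i.+1], so the strict lower bound of a block becomes the
    weak one of interlacing. *)
Lemma in_block_shifted (l : seq nat) (i c : nat) : (i < size l)%N ->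
  in_block (size l) (shifted l) i (c + (size l - i.+1))
  = between (size l) l i c.
Proof.
move=> il; rewrite /in_block /between /shifted leq_add2r; congr (_ && _).
have [iN|//] := ltnP i.+1 (size l).
by rewrite /= -(ltn_add2r (size l - i.+2)); lia.
Qed.

Lemma in_block_ge (l : seq nat) (i c : nat) : (i < size l)%N ->
  in_block (size l) (shifted l) i c -> (size l - i.+1 <= c)%N.
Proof.
by rewrite /in_block /shifted; case: ltnP => /= h il /andP[] h1; lia.
Qed.

Lemma shifted_bound (l : seq nat) (i N : nat) : sorted geq l ->
  (nth 0 l 0 + size l < N)%N -> (shifted l i < N)%N.
Proof.
move=> sl; apply: leq_ltn_trans; rewrite /shifted.
have [il|il] := ltnP i (size l); last by rewrite (nth_default _ il); lia.
by have := sorted_geq_nth _ _ _ sl (leq0n i) il; lia.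
Qed.

Lemma common_bound (l b : seq nat) : sorted geq l -> sorted geq b ->
  exists N, [/\ forall i, (shifted l i < N)%N, forall i, (shifted b i < N)%N,
                forall i, (nth 0 l i < N)%N & forall i, (nth 0 b i < N)%N].
Proof.
move=> Sl Sb; pose N := (nth 0 l 0 + nth 0 b 0 + size l + size b).+1%N.
have lN i : (shifted l i < N)%N by apply: shifted_bound => //; rewrite /N; lia.
have bN i : (shifted b i < N)%N by apply: shifted_bound => //; rewrite /N; lia.
exists N; split=> // i.
  by apply: leq_ltn_trans (lN i); exact: leq_addr.
by apply: leq_ltn_trans (bN i); exact: leq_addr.
Qed.

Lemma rk_odd (r : nat) : rk (2 * r + 1) = r.+1.
Proof. by rewrite /rk addn1 mul2n -doubleS doubleK. Qed.

Lemma rk_even (r : nat) : rk (2 * r) = r.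
Proof. by rewrite /rk mul2n -uphalfE uphalf_double. Qed.

Variable R : comNzRingType.

(** Substituting [c + d] for [c] loses no index: by [in_block_ge] the block has none below [d], and
    [between] excludes those within [d] of [N]. *)
Lemma sum_blocks_shifted (N : nat) (l b : seq nat) (i : nat) (F : nat -> R) :
  size b = size l -> (i < size l)%N -> (shifted l i < N)%N ->
  \sum_(c < N | in_block (size l) (shifted l) i c
             && in_block (size l) (shifted b) i c) F c
  = \sum_(c < N | between (size l) l i c && between (size l) b i c)
      F (c + (size l - i.+1))%N.
Proof.
move=> sb il lN; set d := (size l - i.+1)%N.
have dN : (d <= N)%N by apply: leq_trans (ltnW lN); rewrite leq_addl.
rewrite -(big_mkord (fun c => in_block (size l) (shifted l) i c
             && in_block (size l) (shifted b) i c)).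
rewrite -(big_mkord (fun c => between (size l) l i c && between (size l) b i c)
   (fun c => F (c + d)%N)).
rewrite (big_cat_nat (n := d)) //= big_nat_cond big1 ?add0r; last first.
  move=> c /andP[/andP[_ cd] /andP[/(in_block_ge _ _ _ il)]].
  by rewrite leqNgt cd.
rewrite -{1}[d]add0n big_addn.
rewrite (big_nat_widen _ _ N) ?leq_subr //.
apply: eq_bigl => c.
have bE := in_block_shifted b i c; rewrite sb in bE.
rewrite /d in_block_shifted // bE // -/d.
have [cl|//] := boolP (between _ l i c); rewrite /=.
rewrite (_ : (c < _)%N) ?andbT //.
move: cl lN => /andP[cl _]; rewrite /shifted -/d; lia.
Qed.

(** Interlacing with [l] and [b] constrains each entry of [c] separately, and it forces [c] to be
    sorted, as [c_(i+1) <= l_(i+1) <= c_i]. The index set is thus a product of intervals, and the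
    sum factors by distributivity. *)
Lemma sum_interlacing (r N : nat) (l b : seq nat) (F : nat -> nat -> R) :
  size b = size l -> size l = r \/ size l = r.+1 ->
  (forall i, (nth 0 l i < N)%N) ->
  \sum_(c \in interlacing r l b) \prod_(i < r) F i (nth 0%N c i)
  = \prod_(i < r)
      \sum_(c < N | between (size l) l i c && between (size l) b i c) F i c.
Proof.
move=> sb sl lN.
rewrite (bigA_distr_big_dep (fun (i : 'I_r) (c : 'I_N) =>
  between (size l) l i c && between (size l) b i c) (fun i c => F i c)).
set Q := family _.
rewrite [RHS]bigfs ?index_enum_uniq //; last first.
  by move=> t _; rewrite mem_index_enum.
pose h (t : {ffun 'I_r -> 'I_N}) : r.-tuple nat :=
  [tuple nat_of_ord (t i) | i < r].
have hE t (i : 'I_r) : nth 0%N (h t) i = t i by rewrite -tnth_nth tnth_mktuple.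
have rl : (r <= size l)%N by case: sl => ->.
rewrite (reindex_fsbig h [set` [pred t | t \in Q]]).
  by apply: eq_fsbigr => t _; apply: eq_bigr => i _; rewrite hE.
(* The map [h] sends the box into the interlacing set, is injective, and is onto. *)
split.
- move=> t /= /familyP tQ.
  have tQ' i : (i < r)%N -> between (size l) l i (nth 0%N (h t) i)
                   && between (size l) b i (nth 0%N (h t) i).
    by move=> ir; have /= -> := hE t (Ordinal ir); exact: tQ (Ordinal ir).
  split.
  + apply/(sortedP 0%N) => i; rewrite size_tuple => ir /=.
    have /andP[/andP[h1 _] _] := tQ' _ ir.
    have /andP[/andP[_ /implyP h2] _] := tQ' _ (ltnW ir).
    exact: leq_trans h1 (h2 (leq_trans ir rl)).
  + split; rewrite ?size_tuple //.
      by move=> i /tQ' /andP[/andP[_ /implyP]].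
    by move=> i /tQ' /andP[/andP[]].
  + split; rewrite ?size_tuple ?sb //.
      by move=> i /tQ' /andP[_ /andP[_ /implyP]].
    by move=> i /tQ' /andP[_ /andP[]].
- move=> t u _ _ tu; apply/ffunP => i; apply/val_inj.
  by rewrite /= -!hE tu.
- move=> c [sc [_ cl1 cl2] [_ cb1 cb2]].
  rewrite !size_tuple sb in cl1 cl2 cb1 cb2.
  have cN (i : 'I_r) : (nth 0 c i < N)%N.
    apply: leq_ltn_trans (lN i).
    exact: cl2 i (ltn_ord i) (leq_trans (ltn_ord i) rl).
  exists [ffun i => Ordinal (cN i)].
    apply/familyP => i; rewrite ffunE /= /in_mem /= /between.
    have ir := ltn_ord i; have il := leq_trans ir rl.
    rewrite cl2 // cb2 //=; apply/andP; split; apply/implyP => h'.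
      exact: cl1.
    exact: cb1.
  by apply: eq_from_tnth => i; rewrite tnth_mktuple ffunE /= (tnth_nth 0%N).
Qed.

End Interlacing.

(** After reindexing, the shifts cancel in the exponents and survive only in the argument of [w]. *)
Lemma det_shifted (R : comNzRingType) (q : R) (N n : nat) (w : nat -> R)
    (l b : seq nat) :
  size l = n -> size b = n -> sorted geq l -> sorted geq b ->
  (forall i, (shifted l i < N)%N) ->
  \det (\matrix_(i < n, j < n) \sum_(c < N)
      w c * (trunc_pow _ q (shifted l i) c * trunc_pow _ q (shifted b j) c))
  = \prod_(i < n) \sum_(c < N | between n l i c && between n b i c)
      w (c + (n - i.+1))%N * (q ^+ (nth 0%N l i - c) * q ^+ (nth 0%N b i - c)).
Proof.
move=> ln bn sl sb lN.
have dl : decreasing_upto n (shifted l) by rewrite -ln;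
  exact: shifted_decreasing.
have db : decreasing_upto n (shifted b) by rewrite -bn;
  exact: shifted_decreasing.
rewrite det_trunc_pow //; apply: eq_bigr => i _; subst n.
rewrite (sum_blocks_shifted _ _ _ _ _
  (fun c => w c * (q ^+ (shifted l i - c) * q ^+ (shifted b i - c)))) //.
by apply: eq_bigr => c _; rewrite /shifted bn !subnDr.
Qed.

(** * Kernels as sums of truncated powers, and the two identities *)

Section Kernels.
Variables (R : realType) (q : R).
Hypotheses (q0 : 0 < q) (q1 : q < 1).

(** With [y = x + d], raising [x] by one multiplies the old terms by [q^2] and adds [q^d]: a
    geometric sum. *)
Lemma sum_trunc_pow (N x y : nat) : (x < N)%N -> (y < N)%N ->
  (1 - q ^+ 2) * \sum_(c < N) trunc_pow _ q x c * trunc_pow _ q y c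
  = q ^+ `|x%:Z - y%:Z|%N - q ^+ (x + y + 2).
Proof.
wlog xy : x y / (x <= y)%N => [hw|] xN yN.
  case/orP: (leq_total x y) => xy; first exact: hw.
  rewrite distnC [(x + y)%N]addnC -hw //; congr (_ * _).
  by apply: eq_bigr => c _; rewrite mulrC.
rewrite distnEr // -(subnKC xy) addKn; move: (y - x)%N => d.
transitivity ((1 - q ^+ 2) * \sum_(c < x.+1) q ^+ (x - c) * q ^+ (x + d - c)).
  congr (_ * _); rewrite (big_ord_widen N
    (fun c => q ^+ (x - c) * q ^+ (x + d - c))) //.
  rewrite [RHS]big_mkcond; apply: eq_bigr => c _; rewrite /trunc_pow ltnS.
  case: leqP => cx; last by rewrite mulr0n mul0r.
  by rewrite (leq_trans cx) ?leq_addr // !mulr1n.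
elim: x xN {xy yN} => [_|x IH xN].
  by rewrite big_ord_recl big_ord0 /= !subn0 !add0n exprD; ring.
rewrite big_ord_recr /= subnn addKn expr0 mul1r.
under eq_bigr => c _ do
  rewrite subSn -1?ltnS // addSn subSn ?(leq_trans (ltnSE (ltn_ord c)))
    ?leq_addr // !exprS mulrACA.
rewrite -mulr_sumr mulrDr mulrCA IH ?(ltnW xN) //.
rewrite (_ : x.+1 + (x.+1 + d) + 2 = (x + (x + d) + 2).+2)%N; last by lia.
by rewrite !exprS; ring.
Qed.

Lemma half_kernelE (N m n : nat) : (m < N)%N -> (n < N)%N ->
  (1 - q) / (1 + q) * (q ^+ `|m%:Z - n%:Z|%N - q ^+ (m + n + 2))
  = \sum_(c < N) (1 - q) ^+ 2 * (trunc_pow _ q m c * trunc_pow _ q n c).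
Proof.
move=> mN nN; rewrite -(sum_trunc_pow N) // -mulr_sumr.
by field; rewrite gt_eqF // addr_gt0.
Qed.

(** [Rker] exceeds the kernel of [half_kernelE] by [q (1-q) q^(m+n)], a multiple of the term
    [c = 0]; only that weight changes, from [(1-q)^2] to [1-q]. *)
Lemma RkerE (N m n : nat) : (m < N)%N -> (n < N)%N ->
  Rker q m n = \sum_(c < N) (if c == 0%N :> nat then 1 - q else (1 - q) ^+ 2)
                 * (trunc_pow _ q m c * trunc_pow _ q n c).
Proof.
case: N => // N mN nN.
transitivity (\sum_(c < N.+1)
    (1 - q) ^+ 2 * (trunc_pow _ q m c * trunc_pow _ q n c)
  + (1 - q - (1 - q) ^+ 2) * q ^+ (m + n)).
  rewrite -half_kernelE // /Rker !exprD; field.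
  by rewrite gt_eqF // addr_gt0.
rewrite !big_ord_recl /= [in LHS]/trunc_pow !leq0n !subn0 !mulr1n exprD.
rewrite /trunc_pow !leq0n !subn0 !mulr1n; ring.
Qed.

Lemma sum_weight (N r : nat) (l b : seq nat) :
  size b = size l -> size l = r \/ size l = r.+1 ->
  (forall i, (nth 0%N l i < N)%N) ->
  \sum_(c \in interlacing r l b) ((1 - q) ^+ (2 * r) * weight q r l b c)
  = \prod_(i < r)
      \sum_(c < N | between (size l) l i c && between (size l) b i c)
      ((1 - q) ^+ 2 * (q ^+ (nth 0%N l i - c) * q ^+ (nth 0%N b i - c))).
Proof.
move=> sb sl lN.
rewrite -(sum_interlacing _ _ _ _ _
  (fun i c => (1 - q) ^+ 2 *
    (q ^+ (nth 0%N l i - c) * q ^+ (nth 0%N b i - c)))) //.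
apply: eq_fsbigr => c; rewrite inE => -[_ [_ _ cl] [_ _ cb]].
rewrite size_tuple in cl cb.
(* As [c_i] is at most [l_i] and [b_i], the exponent in [weight] is [(l_i - c_i) + (b_i - c_i)]
   without truncation. *)
rewrite big_split /= prodr_const card_ord -exprM; congr (_ * _).
rewrite /weight -prodrXr; apply: eq_bigr => i _; rewrite -exprD; congr (_ ^+ _).
have rl : (r <= size l)%N by case: sl => ->.
have il := leq_trans (ltn_ord i) rl.
have := cl i (ltn_ord i) il; have := cb i (ltn_ord i).
by rewrite sb => /(_ il); lia.
Qed.

Lemma P_oddE (r : nat) (l b : seq nat) : size l = r.+1 -> size b = r.+1 ->
  sorted geq l -> sorted geq b -> P_odd q r l b = T (2 * r + 1) (phi q) l b.
Proof.
move=> szl szb Sl Sb; have [N [lN bN lN' bN']] := common_bound l b Sl Sb.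
have ea : a_ R (2 * r + 1) = - 2^-1 by rewrite /a_ addn1 mul2n /= odd_double.
rewrite /P_odd /T rk_odd ea.
pose w (c : nat) : R := if c == 0%N then 1 - q else (1 - q) ^+ 2.
rewrite (_ : \matrix_(_, _) _ = \matrix_(i < r.+1, j < r.+1) \sum_(c < N)
  w c * (trunc_pow _ q (shifted l i) c * trunc_pow _ q (shifted b j) c));
    last first.
  by apply/matrixP => i j; rewrite !mxE inner_jacobi_Nhalf // (RkerE N).
rewrite det_shifted // big_ord_recr /=.
(* The last diagonal factor has neither shift nor lower bound, so it is the full kernel sum for
   [Rker]. *)
rewrite (_ : \sum_(c < N | between _ l r c && _) _
    = Rker q (nth 0%N l r) (nth 0%N b r)); last first.
  rewrite (RkerE N) // big_mkcond; apply: eq_bigr => c _.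
  rewrite /between ltnn /= !andbT subnn addn0 /trunc_pow /w.
  by case: (c <= _)%N; case: (c <= _)%N; rewrite /= ?mulr0n ?mulr1n ?mul0r
    ?mulr0.
(* For [i < r] the shift is positive, so the exceptional weight at 0 never occurs. *)
rewrite (eq_bigr (fun i : 'I_r =>
  \sum_(c < N | between (size l) l i c && between (size l) b i c)
    ((1 - q) ^+ 2 * (q ^+ (nth 0%N l i - c) * q ^+ (nth 0%N b i - c)))));
      last first.
  move=> i _; rewrite szl; apply: eq_bigr => c _.
  by rewrite /w (_ : (_ + _ == 0)%N = false) //; apply/negbTE;
    have := ltn_ord i; lia.
rewrite -sum_weight ?szl ?szb //; last by right.
rewrite !mulr_fsuml; apply: eq_fsbigr => c _; ring.
Qed.

(** The weight is constant, so all [r] diagonal factors have the same form; the missing lower bound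
    in the last one matches interlacing of sequences of equal length. *)
Lemma P_evenE (r : nat) (l b : seq nat) : size l = r -> size b = r ->
  sorted geq l -> sorted geq b -> P_even q r l b = T (2 * r) (phi q) l b.
Proof.
move=> szl szb Sl Sb; have [N [lN bN lN' bN']] := common_bound l b Sl Sb.
have ea : a_ R (2 * r) = 2^-1 by rewrite /a_ mul2n odd_double.
rewrite /P_even /T rk_even ea.
rewrite (_ : \matrix_(_, _) _ = \matrix_(i < r, j < r) \sum_(c < N)
  (1 - q) ^+ 2 *
    (trunc_pow _ q (shifted l i) c * trunc_pow _ q (shifted b j) c));
    last first.
  by apply/matrixP => i j; rewrite !mxE inner_jacobi_half // (half_kernelE N).
rewrite (det_shifted _ _ _ _ (fun=> (1 - q) ^+ 2)) //.
have := sum_weight N r l b (etrans szb (esym szl)) (or_introl szl) lN'.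
rewrite szl => <-.
by rewrite mulr_fsuml; apply: eq_fsbigr => c _; ring.
Qed.

End Kernels.

Theorem proposition3p1 (R : realType) (q : R) (hq0 : 0 < q) (hq1 : q < 1) :
  (forall (r : nat) (l b : (rk (2 * r + 1)).-tuple nat),
     W (2 * r + 1) l -> W (2 * r + 1) b ->
     P_odd q r l b = T (2 * r + 1) (phi q) l b)
  /\
  (forall (r : nat), (1 <= r)%N ->
   forall (l b : (rk (2 * r)).-tuple nat),
     W (2 * r) l -> W (2 * r) b ->
     P_even q r l b = T (2 * r) (phi q) l b).
Proof.
split=> [r l b Wl Wb|r _ l b Wl Wb].
- by apply: P_oddE; rewrite // size_tuple rk_odd.
- by apply: P_evenE; rewrite // size_tuple rk_even.
Qed.
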